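(* Algorithm $\mathrm{AG}^0$ (defined in the context), given as input the output of algorithm $\mathrm{AG}^1$ for a project with $n$ states, performs at most $n^2+O(n)$ arithmetic operations.
   Context: Arithmetic operations are additions, subtractions, multiplications and divisions of real numbers; comparisons (including those for picking maximizers) and updates of counters and sets are not counted. Project: finite state space $N$ with $n=|N|$, stochastic matrix $(p_{ij})_{i,j\in N}$, active rewards $R_i\in\mathbb{R}$, startup costs $c_i\ge0$ ($i\in N$), zero shutdown costs, discount factor $0<\beta<1$. For $S\subseteq N$, let $g_i^S,f_i^S$ be the unique solutions of: $g_i^S=1+\beta\sum_{j\in S}p_{ij}g_j^S$ and $f_i^S=R_i+\beta\sum_{j\in S}p_{ij}f_j^S$ for $i\in S$; $g_i^S=f_i^S=0$ for $i\notin S$. For $i\in N$ let $w_i^S=1+\beta\sum_{j\in N}p_{ij}g_j^S-\beta g_i^S$ (which is $>0$), $r_i^S=R_i+\beta\sum_{j\in N}p_{ij}f_j^S-\beta f_i^S$, and $\nu_i^S=r_i^S/w_i^S$. Algorithm $\mathrm{AG}^1$: set $S_1^0=\emptyset$. For $k_1=1,\dots,n$: pick (ties broken arbitrarily) $i_1^{k_1}\in\arg\max\{\nu_i^{S_1^{k_1-1}}:i\in N\setminus S_1^{k_1-1}\}$; set $\nu^*_{i_1^{k_1}}=\nu_{i_1^{k_1}}^{S_1^{k_1-1}}$ and $S_1^{k_1}=S_1^{k_1-1}\cup\{i_1^{k_1}\}$. Write $w_j^{(k_1)}=w_j^{S_1^{k_1}}$ and $\nu_j^{(k_1)}=\nu_j^{S_1^{k_1}}$.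 Output: $\{i_1^{k_1},\ \nu^*_{i_1^{k_1}},\ (w_j^{(k_1)},\nu_j^{(k_1)})_{j\in S_1^{k_1}}\}_{k_1=1}^n$. Algorithm $\mathrm{AG}^0$ (input: the output of $\mathrm{AG}^1$, together with $\beta$ and the $c_j$). Set $\hat c_j=(1-\beta)c_j$ for $j\in N$, $S_0^0=\emptyset$, $S_1^0=\emptyset$, $k_0=0$. For $k_1=1,\dots,n$: - set $S_1^{k_1}=S_1^{k_1-1}\cup\{i_1^{k_1}\}$ and compute $\nu^{(0,k_1)}_{(0,j)}=\nu_j^{(k_1)}-\hat c_j/w_j^{(k_1)}$ for $j\in S_1^{k_1}\setminus S_0^{k_0}$; - while $k_0<k_1$: pick (ties broken arbitrarily) $j_0^{\max}\in\arg\max\{\nu^{(0,k_1)}_{(0,j)}:j\in S_1^{k_1}\setminus S_0^{k_0}\}$; if $k_1=n$ or $\nu^*_{i_1^{k_1+1}}<\nu^{(0,k_1)}_{(0,j_0^{\max})}$, then set $i_0^{k_0+1}=j_0^{\max}$, $\nu^*_{(0,i_0^{k_0+1})}=\nu^{(0,k_1)}_{(0,i_0^{k_0+1})}$, $S_0^{k_0+1}=S_0^{k_0}\cup\{i_0^{k_0+1}\}$, and increase $k_0$ by $1$; otherwise exit the while loop (and proceed to the next $k_1$). Output: $\{i_0^{k_0},\nu^*_{(0,i_0^{k_0})}\}_{k_0=1}^n$. *)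

(* Defs.v *)
From HB Require Import structures.
From mathcomp Require Import all_boot all_order all_algebra.
From mathcomp Require Import reals.
From mathcomp Require classical_sets.

Set Implicit Arguments.
Unset Strict Implicit.
Unset Printing Implicit Defensive.
Import Order.TTheory GRing.Theory Num.Theory.
Local Open Scope ring_scope.

Record project (R : realType) (N : finType) := Project {
  trans : N -> N -> R;
  reward : N -> R;
  startup : N -> R;
  discount : R;
  trans_ge0 : forall i j, 0 <= trans i j;
  trans_sum1 : forall i, \sum_j trans i j = 1;
  startup_ge0 : forall i, 0 <= startup i;
  discount_gt0 : 0 < discount;
  discount_lt1 : discount < 1
}.

Section Metrics.
Variables (R : realType) (N : finType) (P : project R N).
Local Notation beta := (discount P).
Local Notation p := (trans P).

(* The system solved by g^S (for u = 1) and by f^S (for u the rewards). *)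
Definition solves (u : N -> R) (S : {set N}) (h : {ffun N -> R}) : Prop :=
  (forall i, i \in S -> h i = u i + beta * \sum_(j in S) p i j * h j) /\
  (forall i, i \notin S -> h i = 0).

Definition solution (u : N -> R) (S : {set N}) : {ffun N -> R} :=
  classical_sets.xget [ffun=> 0] (solves u S).

Lemma solves_homog_eq0 (S : {set N}) (h : {ffun N -> R}) :
  solves (fun=> 0) S h -> h = [ffun=> 0].
Proof.
move=> [hS hSn]; apply/ffunP => k; rewrite ffunE; apply/eqP.
have [i _ imax] := @arg_maxP _ R N k predT (fun i => `|h i|) isT.
suff hi0 : `|h i| <= 0.
  by rewrite -normr_le0; apply: le_trans hi0; apply: imax.
have b0 := discount_gt0 P.
case: (boolP (i \in S)) => [iS|iSn]; last by rewrite hSn ?normr0.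
have hle : `|h i| <= beta * `|h i|.
  rewrite {1}hS // add0r normrM gtr0_norm // ler_pM2l //.
  apply: le_trans (ler_norm_sum _ _ _) _.
  apply: (@le_trans _ _ (\sum_(j in S) p i j * `|h i|)).
    apply: ler_sum => j _; rewrite normrM ger0_norm ?trans_ge0 //.
    by rewrite ler_wpM2l ?trans_ge0 //; apply: imax.
  rewrite -mulr_suml -[leRHS]mul1r -(trans_sum1 P i) ler_wpM2r //.
  rewrite [leRHS](bigID [in S]) /= lerDl; apply: sumr_ge0 => j _.
  exact: trans_ge0.
by move: hle; rewrite -subr_ge0 -{2}[`|h i|]mul1r -mulrBl nmulr_rge0 ?subr_lt0 //;
  apply: discount_lt1.
Qed.

Lemma solves_uniq (u : N -> R) (S : {set N}) (h h' : {ffun N -> R}) :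
  solves u S h -> solves u S h' -> h = h'.
Proof.
move=> [h1 h2] [h1' h2']; apply/ffunP => i; apply/eqP; rewrite -subr_eq0.
have -> : h i - h' i = [ffun j => h j - h' j] i by rewrite ffunE.
rewrite (@solves_homog_eq0 S [ffun j => h j - h' j]) ?ffunE //; split=> k kS.
  rewrite !ffunE h1 // h1' // add0r opprD addrACA subrr add0r -mulrBr -sumrB.
  by congr (_ * _); apply: eq_bigr => j _; rewrite ffunE mulrBr.
by rewrite ffunE h2 // h2' // subrr.
Qed.

Lemma solves_ex (u : N -> R) (S : {set N}) :
  exists h : {ffun N -> R}, solves u S h.
Proof.
pose A (h : {ffun N -> R^o}) : {ffun N -> R^o} :=
  [ffun i => h i - (if i \in S then beta * \sum_(j in S) p i j * h j else 0)].
have Alin : linear A.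
  move=> a x y; apply/ffunP => i; rewrite /A !ffunE.
  case: ifP => _; last by rewrite !subr0.
  rewrite scalerBr addrACA -opprD; congr (_ - _).
  rewrite /GRing.scale /= [a * _]mulrCA -mulrDr; congr (_ * _).
  rewrite mulr_sumr -big_split; apply: eq_bigr => j _ /=.
  by rewrite !ffunE mulrDr /GRing.scale /= mulrCA.
pose AL := GRing.isLinear.Build R {ffun N -> R^o} {ffun N -> R^o} _ A Alin.
pose f : {linear {ffun N -> R^o} -> {ffun N -> R^o}} := HB.pack A AL.
have ker0 : lker (linfun f) == 0%VS.
  rewrite -subv0; apply/subvP => h; rewrite memv_ker memv0 lfunE /= => /eqP Ah.
  apply/eqP; rewrite [LHS](@solves_homog_eq0 S) //.
  have Ahi i : A h i = 0 by rewrite Ah ffunE.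
  split=> i iS; move: (Ahi i); rewrite ffunE.
    by rewrite iS add0r => /subr0_eq.
  by rewrite (negPf iS) subr0.
pose v : {ffun N -> R^o} := [ffun i => if i \in S then u i else 0].
have := lker0_lfunVK ker0 v; rewrite lfunE /=.
move: (_^-1%VF v) => h /ffunP Ah; exists h.
split=> i iS; move: (Ah i); rewrite !ffunE.
  by rewrite iS => /eqP; rewrite subr_eq => /eqP.
by rewrite (negPf iS) subr0.
Qed.

Lemma solutionP (u : N -> R) (S : {set N}) : solves u S (solution u S).
Proof. exact: classical_sets.xgetPex (solves_ex u S). Qed.

Definition g_sol (S : {set N}) := solution (fun=> 1) S.
Definition f_sol (S : {set N}) := solution (reward P) S.

Definition w_rate (S : {set N}) (i : N) : R :=
  1 + beta * \sum_j p i j * g_sol S j - beta * g_sol S i.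
Definition r_rate (S : {set N}) (i : N) : R :=
  reward P i + beta * \sum_j p i j * f_sol S j - beta * f_sol S i.
Definition nu_rate (S : {set N}) (i : N) : R := r_rate S i / w_rate S i.

End Metrics.

Definition argmax (R : realType) (N : finType) (S : {set N}) (v : N -> R) :
    {set N} :=
  [set i in S | [forall j in S, v j <= v i]].

Lemma argmax_neq0 (R : realType) (N : finType) (S : {set N}) (v : N -> R) :
  S != set0 -> argmax S v != set0.
Proof.
case/set0Pn => j jS; have [i iS imax] := @arg_maxP _ R N j (mem S) v jS.
apply/set0Pn; exists i; rewrite inE; apply/andP; split=> //.
by apply/forall_inP => k kS; exact: imax.
Qed.

(* The counters k_1 run from 1 to #|N|, as in the pseudocode: the values of
   ag1_state, ag1_w, ag1_nu at other k, and those of ag1_w k, ag1_nu k outside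
   visited ag1_state k, carry no information. *)
Record ag1_data (T : Type) (N : finType) := Ag1Data {
  ag1_state : nat -> N;          (* i_1^k *)
  ag1_index : N -> T;            (* nu^*_i *)
  ag1_w : nat -> N -> T;         (* w_j^(k) *)
  ag1_nu : nat -> N -> T         (* nu_j^(k) *)
}.

(* S_1^k = {i_1^1, ..., i_1^k} *)
Fixpoint visited (N : finType) (i1 : nat -> N) (k : nat) : {set N} :=
  if k is k'.+1 then visited i1 k' :|: [set i1 k] else set0.

(* o is the output of some run of AG^1 (some way of breaking ties). *)
Definition AG1_output (R : realType) (N : finType) (P : project R N)
    (o : ag1_data R N) : Prop :=
  forall k : nat, (1 <= k <= #|N|)%N ->
  let S := visited (ag1_state o) k.-1 in
  let S' := visited (ag1_state o) k in
  [/\ ag1_state o k \in argmax (~: S) (nu_rate P S),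
      ag1_index o (ag1_state o k) = nu_rate P S (ag1_state o k)
    & forall j, j \in S' ->
        ag1_w o k j = w_rate P S' j /\ ag1_nu o k j = nu_rate P S' j].

(* Programs on numbers of a type T that they can only access through the
   four arithmetic operations, a comparison test, and the selection of a
   maximizer of v over s. As T is abstract when a program is written, no
   arithmetic can escape the count. *)
Variant arith_op := OpAdd | OpSub | OpMul | OpDiv.

Inductive prog (T : Type) (N : finType) (A : Type) : Type :=
| Ret of A
| Arith of arith_op & T & T & (T -> prog T N A)
| Less of T & T & (bool -> prog T N A)
| PickMax (s : {set N}) (v : N -> T) of (N -> prog T N A).

Arguments Ret {T N A}.
Arguments Arith {T N A}.
Arguments Less {T N A}.
Arguments PickMax {T N A}.

Fixpoint bind (T : Type) (N : finType) (A B : Type)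
    (c : prog T N A) (f : A -> prog T N B) : prog T N B :=
  match c with
  | Ret a => f a
  | Arith o x y k => Arith o x y (fun z => bind (k z) f)
  | Less x y k => Less x y (fun b => bind (k b) f)
  | PickMax s v k => PickMax s v (fun j => bind (k j) f)
  end.

Definition arith_eval (R : realType) (o : arith_op) (x y : R) : R :=
  match o with
  | OpAdd => x + y
  | OpSub => x - y
  | OpMul => x * y
  | OpDiv => x / y
  end.

(* The largest number of arithmetic operations over all executions, that is,
   over all ways of breaking the ties. The maximum over an empty argmax is 0,
   but by argmax_neq0 this only arises if s is empty, which never happens in
   AG0 run on an output of AG^1: when m > 0 in ag0_while, S_1 :\: S_0 has k_1 - k_0 = m elements. *)
Fixpoint arith_cost (R : realType) (N : finType) (A : Type) (c : prog R N A) :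
    nat :=
  match c with
  | Ret _ => 0%N
  | Arith o x y k => (arith_cost (k (arith_eval o x y))).+1
  | Less x y k => arith_cost (k (x < y))
  | PickMax s v k => (\max_(j in argmax s v) arith_cost (k j))%N
  end.

Section AG0.
Variables (T : Type) (N : finType).

(* Overwrites v j with the result of f j, for j running through s. *)
Fixpoint fill (s : seq N) (f : N -> prog T N T) (v : N -> T) :
    prog T N (N -> T) :=
  if s is j :: s' then bind (f j) (fun x => fill s' f [eta v with j |-> x])
  else Ret v.

Fixpoint for_loop (A : Type) (s : seq nat) (body : nat -> A -> prog T N A)
    (a : A) : prog T N A :=
  if s is k :: s' then bind (body k a) (for_loop s' body) else Ret a.

(* k_0, S_0^{k_0}, S_1^{k_1}, and the list of the (i_0^k, nu^*_(0,i_0^k)) *)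
Record ag0_state := Ag0State {
  ag0_k0 : nat;
  ag0_S0 : {set N};
  ag0_S1 : {set N};
  ag0_out : seq (N * T)
}.

Definition ag0_add (nu0 : N -> T) (j : N) (st : ag0_state) : ag0_state :=
  Ag0State (ag0_k0 st).+1 (ag0_S0 st :|: [set j]) (ag0_S1 st)
           (rcons (ag0_out st) (j, nu0 j)).

(* The while loop: m = k_1 - k_0, so that the guard k_0 < k_1 is 0 < m. *)
Fixpoint ag0_while (o : ag1_data T N) (k1 : nat) (nu0 : N -> T) (m : nat)
    (st : ag0_state) : prog T N ag0_state :=
  if m is m'.+1 then
    PickMax (ag0_S1 st :\: ag0_S0 st) nu0 (fun j =>
      if k1 == #|N| then ag0_while o k1 nu0 m' (ag0_add nu0 j st)
      else Less (ag1_index o (ag1_state o k1.+1)) (nu0 j) (fun b =>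
        if b then ag0_while o k1 nu0 m' (ag0_add nu0 j st) else Ret st))
  else Ret st.

Definition ag0_step (o : ag1_data T N) (chat : N -> T) (k1 : nat)
    (st0 : ag0_state) : prog T N ag0_state :=
  let st := Ag0State (ag0_k0 st0) (ag0_S0 st0)
              (ag0_S1 st0 :|: [set ag1_state o k1]) (ag0_out st0) in
  bind (fill (enum (ag0_S1 st :\: ag0_S0 st))
             (fun j => Arith OpDiv (chat j) (ag1_w o k1 j) (fun q =>
                       Arith OpSub (ag1_nu o k1 j) q Ret))
             (ag1_nu o k1))
       (fun nu0 => ag0_while o k1 nu0 (k1 - ag0_k0 st)%N st).

(* The argument one stands for the constant 1 of T. *)
Definition AG0 (one beta : T) (c : N -> T) (o : ag1_data T N) :
    prog T N (seq (N * T)) :=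
  bind (fill (enum N)
             (fun j => Arith OpSub one beta (fun d => Arith OpMul d (c j) Ret)) c)
  (fun chat =>
  bind (for_loop (iota 1 #|N|) (ag0_step o chat) (Ag0State 0 set0 set0 [::]))
  (fun st => Ret (ag0_out st))).

End AG0.

(* Main.v *)
Require Import Defs.
From mathcomp Require Import all_boot all_order all_algebra.
From mathcomp Require Import reals.
From mathcomp Require Import zify.

(** While [k_1] is processed, [S_1] has at most [k_1] elements, so updating
    the indices [nu_(0,j)] costs at most [2 k_1] operations, and the while loop
    costs none.  Summing over [k_1] gives [n (n + 1)]; computing the scaled
    startup costs adds [2 n]. *)

Set Implicit Arguments.
Unset Strict Implicit.
Unset Printing Implicit Defensive.

(* [Q] is required on every branch, whether or not an execution reaches it:
   for [AG0] this is enough to bound the cardinal of [S_1]. *)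
Fixpoint returns (T : Type) (N : finType) (A : Type) (Q : A -> Prop)
    (c : prog T N A) : Prop :=
  match c with
  | Ret a => Q a
  | Arith _ _ _ k => forall z, returns Q (k z)
  | Less _ _ k => forall b, returns Q (k b)
  | PickMax _ _ k => forall j, returns Q (k j)
  end.

Lemma returns_true (T : Type) (N : finType) (A : Type) (c : prog T N A) :
  returns (fun=> True) c.
Proof. by elim: c => /=. Qed.

Lemma returns_impl (T : Type) (N : finType) (A : Type) (Q Q' : A -> Prop)
    (c : prog T N A) :
  (forall a, Q a -> Q' a) -> returns Q c -> returns Q' c.
Proof.
move=> QQ'; elim: c => [a|op x y k IH|x y k IH|s v k IH] /= cQ.
- exact: QQ'.
- by move=> z; apply: IH.
- by move=> b; apply: IH.
- by move=> j; apply: IH.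
Qed.

Lemma returns_bind (T : Type) (N : finType) (A B : Type) (Q : A -> Prop)
    (Q' : B -> Prop) (c : prog T N A) (f : A -> prog T N B) :
  returns Q c -> (forall a, Q a -> returns Q' (f a)) -> returns Q' (bind c f).
Proof.
move=> + fQ; elim: c => [a|op x y k IH|x y k IH|s v k IH] /= cQ.
- exact: fQ.
- by move=> z; apply: IH.
- by move=> b; apply: IH.
- by move=> j; apply: IH.
Qed.

Section Cost.
Variables (R : realType) (N : finType).

(** A [PickMax] node costs the maximum over its branches, so a bound [m] uniform over the values
    satisfying [Q] adds to the whole maximum. *)
Lemma arith_cost_bind (A B : Type) (Q : A -> Prop) (m : nat)
    (c : prog R N A) (f : A -> prog R N B) :
  returns Q c -> (forall a, Q a -> arith_cost (f a) <= m) ->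
  arith_cost (bind c f) <= arith_cost c + m.
Proof.
move=> + fm; elim: c => [a|op x y k IH|x y k IH|s v k IH] /= cQ.
- exact: fm.
- by rewrite addSn ltnS; apply: IH.
- exact: IH.
- apply/bigmax_leqP => j js; apply: leq_trans (IH j (cQ j)) _.
  rewrite leq_add2r.
  exact: (@leq_bigmax_cond _ [in argmax s v] (fun j => arith_cost (k j)) j js).
Qed.

Lemma arith_cost_fill (d : nat) (s : seq N) (f : N -> prog R N R) (v : N -> R) :
  (forall j, arith_cost (f j) <= d) -> arith_cost (fill s f v) <= size s * d.
Proof.
move=> fd; elim: s v => [|j s IH] v //=; rewrite mulSn.
apply: leq_trans (arith_cost_bind (returns_true _) (fun x _ => IH _)) _.
by rewrite leq_add2r.
Qed.

(** Both the invariant and the bound depend on the counter: charging each iteration its own [F i],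
    not a common maximum, is what gives leading coefficient 1 instead of 2. *)
Lemma arith_cost_for_loop (A : Type) (Q : nat -> A -> Prop) (F : nat -> nat)
    (body : nat -> A -> prog R N A) (k m : nat) (a : A) :
  (forall i b, Q i b -> returns (Q i.+1) (body i b)) ->
  (forall i b, Q i b -> arith_cost (body i b) <= F i) ->
  Q k a ->
  arith_cost (for_loop (iota k m) body a) <= \sum_(i <- iota k m) F i.
Proof.
move=> bodyQ bodyF; elim: m k a => [|m IH] k a Qka //=; rewrite big_cons.
apply: leq_trans (arith_cost_bind (bodyQ k a Qka) (IH k.+1)) _.
by rewrite leq_add2r bodyF.
Qed.

Lemma arith_cost_ag0_while (o : ag1_data R N) (k1 : nat) (nu0 : N -> R)
    (m : nat) (st : ag0_state R N) :
  arith_cost (ag0_while o k1 nu0 m st) = 0.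
Proof.
elim: m st => [|m IH] st //=; apply: big1 => j _.
by case: ifP => _ //=; case: ifP.
Qed.

End Cost.

Lemma returns_ag0_while (T : Type) (N : finType) (o : ag1_data T N) (k1 : nat)
    (nu0 : N -> T) (m : nat) (st : ag0_state T N) :
  returns (fun st' => ag0_S1 st' = ag0_S1 st) (ag0_while o k1 nu0 m st).
Proof.
elim: m st => [|m IH] st //= j.
(* [ag0_add] enlarges only [ag0_S0], so the induction hypothesis applies up to conversion. *)
by case: ifP => _ /=; [apply: IH (ag0_add nu0 j st) |
   case=> //=; apply: IH (ag0_add nu0 j st)].
Qed.

Lemma returns_ag0_step (T : Type) (N : finType) (o : ag1_data T N)
    (chat : N -> T) (k1 : nat) (st : ag0_state T N) :
  returns (fun st' => ag0_S1 st' = ag0_S1 st :|: [set ag1_state o k1])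
    (ag0_step o chat k1 st).
Proof.
apply: returns_bind (returns_true _) _ => nu0 _.
exact: (returns_ag0_while _ _ _ _ (Ag0State _ _ (_ :|: _) _)).
Qed.

Lemma arith_cost_ag0_step (R : realType) (N : finType) (o : ag1_data R N)
    (chat : N -> R) (k1 : nat) (st : ag0_state R N) :
  arith_cost (ag0_step o chat k1 st)
    <= #|ag0_S1 st :|: [set ag1_state o k1]| * 2.
Proof.
apply: leq_trans (@arith_cost_bind _ _ _ _ _ 0 _ _ (returns_true _) _) _.
  by move=> nu0 _; rewrite arith_cost_ag0_while.
rewrite addn0; apply: leq_trans (arith_cost_fill (d := 2) _ _ _) _ => //.
(* Each refreshed index takes one division and one subtraction. Dropping [ag0_S0] covers the worst
   case, in which it is still empty. *)
by rewrite -cardE leq_mul2r subset_leq_card // subsetDl.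
Qed.

Theorem proposition5p2 :
  exists C : nat,
  forall (R : realType) (N : finType) (P : project R N) (o : ag1_data R N),
    AG1_output P o ->
    (arith_cost (AG0 1%R (discount P) (startup P) o) <= #|N| ^ 2 + C * #|N|)%N.
Proof.
(* One [#|N|] comes from the linear term of [n * (n + 1)], two from the scaled startup costs. *)
exists 3 => R N P o _.
(* The inequality is strict because the invariant holds on entry to iteration [k], before its state
   is added; it starts with the empty set at [k = 1]. *)
pose small k (st : ag0_state R N) := #|ag0_S1 st| < k.
have card_S1 k (st : ag0_state R N) : small k st ->
    #|ag0_S1 st :|: [set ag1_state o k]| <= k.
  move=> lt_st_k; apply: leq_trans (leq_card_setU _ _) _.
  by rewrite cards1 addn1.
have loop_cost chat : arith_cost (for_loop (iota 1 #|N|) (ag0_step o chat)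
    (Ag0State 0 set0 set0 [::])) <= \sum_(i <- iota 1 #|N|) i * 2.
  apply: (arith_cost_for_loop (Q := small)) => [k st st_k|k st st_k|].
  - apply: returns_impl (returns_ag0_step o chat k st) => st' eq_st'.
    by rewrite /small eq_st' ltnS card_S1.
  - apply: leq_trans (arith_cost_ag0_step _ _ _ _) _.
    by rewrite leq_mul2r card_S1.
  - by rewrite /small cards0.
have sum_iota n : \sum_(i <- iota 1 n) i * 2 = n ^ 2 + n.
  (* The last term of the sum is split off, as [iota] unfolds from the front. *)
  elim: n => [|n IH]; first by rewrite big_nil.
  by rewrite -{1}(addn1 n) iotaD big_cat IH big_seq1 add1n -!mulnn /=; lia.
apply: leq_trans (arith_cost_bind (m := #|N| ^ 2 + #|N|) (returns_true _) _) _.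
  move=> chat _; rewrite -sum_iota -[leqRHS]addn0.
  (* Reading off [ag0_out] after the loop is free. *)
  apply: leq_trans (arith_cost_bind (m := 0) (returns_true _) _) _ => //.
  by rewrite leq_add2r.
(* [AG0] recomputes [1 - beta] for every state, hence two operations per scaled cost. *)
apply: (@leq_trans (#|N| * 2 + (#|N| ^ 2 + #|N|))); last lia.
by rewrite leq_add2r cardE; apply: arith_cost_fill.
Qed.
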